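(* For any positive integer $k$, we have $N'_k(3) \leq N_k(3) \leq 11k-2$; in particular every tournament $T$ on $n \ge 11k-2$ vertices satisfies $\mathrm{sinv}'_k(T)\le \mathrm{sinv}_k(T) \leq 3$.
   Context: A tournament is an orientation of a complete graph. For a digraph $D$ and $X \subseteq V(D)$, inverting $X$ means reversing the direction of every arc of $D$ with both endvertices in $X$. A digraph $D$ is $k$-arc-strong if for every partition $(V_1,V_2)$ of $V(D)$ into nonempty sets there are at least $k$ arcs from $V_1$ to $V_2$; it is $k$-strong if $|V(D)|\ge k+1$ and $D-S$ is strongly connected for every $S\subseteq V(D)$ with $|S|<k$. $\mathrm{sinv}'_k(D)$ (resp. $\mathrm{sinv}_k(D)$) is the minimum number of sets whose successive inversion transforms $D$ into a $k$-arc-strong (resp. $k$-strong) digraph. For $n \ge 2k+1$, $m_k(n) = \max\{\mathrm{sinv}_k(T) : T \text{ tournament of order } n\}$ and $m'_k(n) = \max\{\mathrm{sinv}'_k(T) : T \text{ tournament of order } n\}$. For positive integers $k,i$, $N_k(i)$ (resp. $N'_k(i)$) is the smallest integer such that $m_k(n) \leq i$ (resp. $m'_k(n)\le i$) for all $n \geq N_k(i)$ (resp. $n\ge N'_k(i)$). *)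

(* Defs.v *)
From mathcomp Require Import all_boot.
From Stdlib Require Import ClassicalEpsilon.
Set Implicit Arguments. Unset Strict Implicit. Unset Printing Implicit Defensive.

(* A digraph on vertex set 'I_n (no multiple arcs): D (x,y) = true iff x->y is an arc. *)
Definition digraph (n : nat) := {ffun 'I_n * 'I_n -> bool}.

Definition is_tournament n (D : digraph n) : bool :=
  [forall x, ~~ D (x, x)] &&
  [forall x, forall y, (x != y) ==> (D (x, y) (+) D (y, x))].

Definition invert n (D : digraph n) (X : {set 'I_n}) : digraph n :=
  [ffun p => if (p.1 \in X) && (p.2 \in X) then D (p.2, p.1) else D p].

Definition invert_seq n (D : digraph n) (s : seq {set 'I_n}) : digraph n :=
  foldl (@invert n) D s.

Definition arc_strong n (k : nat) (D : digraph n) : bool :=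
  [forall V1 : {set 'I_n}, ((V1 != set0) && (~: V1 != set0)) ==>
     (k <= #|[set p : 'I_n * 'I_n | (p.1 \in V1) && (p.2 \in ~: V1) && D p]|)].

Definition strong_minus n (D : digraph n) (S : {set 'I_n}) : bool :=
  [forall x, forall y, ((x \notin S) && (y \notin S)) ==>
     connect [rel u v | (u \notin S) && (v \notin S) && D (u, v)] x y].

Definition vertex_strong n (k : nat) (D : digraph n) : bool :=
  (k.+1 <= n) && [forall S : {set 'I_n}, (#|S| < k) ==> strong_minus D S].

Definition inv_reach n (P : pred (digraph n)) (D : digraph n) (m : nat) : bool :=
  [exists s : m.-tuple {set 'I_n}, P (invert_seq D s)].

(* Minimum number of inversions making D satisfy P (0 by convention if impossible,
   which never happens for the cases used). *)
Definition sinv_gen n (P : pred (digraph n)) (D : digraph n) : nat :=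
  match excluded_middle_informative (exists m, inv_reach P D m) with
  | left ex => ex_minn ex
  | right _ => 0
  end.

Definition sinv n (k : nat) (D : digraph n) : nat := sinv_gen (vertex_strong k) D.
Definition sinv' n (k : nat) (D : digraph n) : nat := sinv_gen (arc_strong k) D.

Definition m_k (k n : nat) : nat :=
  \max_(T : digraph n | is_tournament T) sinv k T.
Definition m'_k (k n : nat) : nat :=
  \max_(T : digraph n | is_tournament T) sinv' k T.

(* N is a valid threshold for value i: m n <= i for all n >= N in the domain n >= 2k+1.
   N_k(i) (resp. N'_k(i)) is the least N with threshold (m_k k) k i N
   (resp. threshold (m'_k k) k i N). *)
Definition threshold (m : nat -> nat) (k i N : nat) : Prop :=
  forall n, N <= n -> (2 * k).+1 <= n -> m n <= i.

(* Main.v *)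
Require Import Defs.
From mathcomp Require Import all_boot zify.
Set Implicit Arguments. Unset Strict Implicit. Unset Printing Implicit Defensive.

(** Give each vertex the vector in F_2^3 recording which of the three inverted
sets contain it: an arc is reversed iff the vectors of its ends have odd inner
product.  It is enough to make some subtournament H k-strong while every other
vertex has at least k in- and k out-neighbours in H; the latter costs nothing,
since reversing the arcs between a bad vertex and 2k-1 vertices of H, but not
those to another 2k-1, repairs it.

Suppose A nearly dominates two disjoint sets B and C of size 2k-1.  Reverse
all arcs between A and C, and switch rows and columns of the B x C adjacency
matrix so that the number of arcs from B to C is maximal; then each row and
column has a majority, hence at least k, of arcs from B to C, and the blown-up
triangle A -> B -> C -> A is k-strong.

Such a triple always exists unless there is a k-strong core.  While the
remaining set K is not k-strong, it has parts L, R with all arcs from L to R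
and fewer than k further vertices.  If one part has fewer than k vertices,
remove it: a removed source (sink) has fewer than k in-neighbours
(out-neighbours) in what is left, and 2k-1 sources or 2k-1 sinks yield the
triple.  If both parts have at least k vertices, then L, R and the vertices
removed before yield it. *)

(** * Strength through cuts *)

Definition tourn (V : finType) (E : rel V) :=
  irreflexive E /\ forall x y, x != y -> E x y = ~~ E y x.

Definition op_rel (V : finType) (E : rel V) : rel V := fun x y => E y x.

Definition out_in (V : finType) (E : rel V) (A : {set V}) v :=
  #|[set u in A | E v u]|.

Definition in_from (V : finType) (E : rel V) (A : {set V}) v :=
  #|[set u in A | E u v]|.

(** The cut form of strong connectivity avoids paths and is invariant under reversal of all arcs;
    the deleted set is [H :\: (X :|: Y)]. The size condition of k-strength enters only in
    [cut_strong_vertex]. *)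
Definition cut_strong (V : finType) (E : rel V) (H : {set V}) k : bool :=
  [forall X : {set V}, forall Y : {set V},
    [&& X \subset H, Y \subset H, X != set0, Y != set0, [disjoint X & Y]
      & #|H :\: (X :|: Y)| < k] ==> [exists x in X, exists y in Y, E x y]].

Lemma tourn_op (V : finType) (E : rel V) : tourn E -> tourn (op_rel E).
Proof.
move=> [irr tot]; split=> [x|x y xy]; first exact: irr.
by rewrite /op_rel tot // eq_sym.
Qed.

Lemma cut_strongI (V : finType) (E : rel V) (H : {set V}) k :
  (forall (X Y S : {set V}) x0 y0, x0 \in X -> y0 \in Y -> #|S| < k ->
     X \subset H -> Y \subset H -> [disjoint X & Y] ->
     (forall v, v \in H -> v \notin S -> (v \in X) || (v \in Y)) ->
     (forall x y, x \in X -> y \in Y -> ~~ E x y) -> False) ->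
  cut_strong E H k.
Proof.
move=> hyp; apply/forallP=> X; apply/forallP=> Y; apply/implyP.
move=> /and5P[XH YH /set0Pn[x0 x0X] /set0Pn[y0 y0Y] /andP[dis small]].
apply: contraT => noarc; exfalso.
apply: (hyp X Y (H :\: (X :|: Y)) x0 y0) => //.
- by move=> v vH; rewrite !inE vH andbT negbK.
- move=> x y xX yY; apply: contra noarc => Exy.
  by apply/exists_inP; exists x => //; apply/exists_inP; exists y.
Qed.

Lemma cut_strongE (V : finType) (E : rel V) (H : {set V}) k (X Y : {set V}) :
  cut_strong E H k -> X \subset H -> Y \subset H -> X != set0 -> Y != set0 ->
  [disjoint X & Y] -> #|H :\: (X :|: Y)| < k ->
  exists x y, [/\ x \in X, y \in Y & E x y].
Proof.
move=> /forallP/(_ X)/forallP/(_ Y)/implyP sH XH YH X0 Y0 dis small.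
have /sH/exists_inP[x xX /exists_inP[y yY Exy]] :
  [&& X \subset H, Y \subset H, X != set0, Y != set0, [disjoint X & Y]
      & #|H :\: (X :|: Y)| < k] by rewrite XH YH X0 Y0 dis small.
by exists x, y.
Qed.

Lemma cut_not_strong (V : finType) (E : rel V) (H : {set V}) k :
  ~~ cut_strong E H k ->
  exists X Y : {set V}, [/\ X \subset H, Y \subset H, X != set0, Y != set0
    & [/\ [disjoint X & Y], #|H :\: (X :|: Y)| < k
        & forall x y, x \in X -> y \in Y -> ~~ E x y]].
Proof.
rewrite negb_forall => /existsP[X]; rewrite negb_forall => /existsP[Y].
rewrite negb_imply => /andP[/and5P[XH YH X0 Y0 /andP[dis small]] noarc].
exists X, Y; do 2!split=> //; move=> x y xX yY; apply: contra noarc => Exy.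
by apply/exists_inP; exists x => //; apply/exists_inP; exists y.
Qed.

Lemma card_gt_avoid (V : finType) (P S : {set V}) k :
  #|S| < k -> k <= #|P| -> exists2 u, u \in P & u \notin S.
Proof.
move=> Sk kP; have : P :\: S != set0.
  rewrite -card_gt0 cardsD.
  have := subset_leq_card (subsetIr P S); lia.
by move=> /set0Pn[u]; rewrite inE => /andP[uS uP]; exists u.
Qed.

(** Fewer than [k] out-neighbours are deleted, and a surviving one cannot lie in [Y]. *)
Lemma cut_forward (V : finType) (E : rel V) (H X Y S A : {set V}) k x :
  #|S| < k -> A \subset H ->
  (forall v, v \in H -> v \notin S -> (v \in X) || (v \in Y)) ->
  (forall x y, x \in X -> y \in Y -> ~~ E x y) ->
  x \in X -> k <= out_in E A x -> exists2 u, u \in A & u \in X.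
Proof.
move=> Sk AH cov noarc xX /(card_gt_avoid Sk)[u]; rewrite inE => /andP[uA Exu] uS.
exists u => //; have := cov u (subsetP AH _ uA) uS.
by case/orP => // uY; have := noarc _ _ xX uY; rewrite Exu.
Qed.

Lemma cut_backward (V : finType) (E : rel V) (H X Y S A : {set V}) k y :
  #|S| < k -> A \subset H ->
  (forall v, v \in H -> v \notin S -> (v \in X) || (v \in Y)) ->
  (forall x y, x \in X -> y \in Y -> ~~ E x y) ->
  y \in Y -> k <= in_from E A y -> exists2 u, u \in A & u \in Y.
Proof.
move=> Sk AH cov noarc yY /(card_gt_avoid Sk)[u]; rewrite inE => /andP[uA Euy] uS.
exists u => //; have := cov u (subsetP AH _ uA) uS.
by case/orP => // uX; have := noarc _ _ uX yY; rewrite Euy.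
Qed.

(** By [cut_forward] and [cut_backward] both sides of a cut meet [H], so the cut restricts to one of
    [H]. *)
Lemma cut_strong_extend (V : finType) (E : rel V) (H : {set V}) k :
  cut_strong E H k ->
  (forall v, v \notin H -> k <= out_in E H v /\ k <= in_from E H v) ->
  cut_strong E setT k.
Proof.
move=> sH ext; apply: cut_strongI => X Y S x0 y0 x0X y0Y Sk _ _ dis cov noarc.
have [x xX xH] : exists2 x, x \in X & x \in H.
  have [x0H|/ext[o _]] := boolP (x0 \in H); first by exists x0.
  have [u uH uX] := cut_forward Sk (subsetT H) cov noarc x0X o; by exists u.
have [y yY yH] : exists2 y, y \in Y & y \in H.
  have [y0H|/ext[_ i]] := boolP (y0 \in H); first by exists y0.
  have [u uH uY] := cut_backward Sk (subsetT H) cov noarc y0Y i; by exists u.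
have [|||||| a [b [+ + Eab]]] := @cut_strongE _ E H k (X :&: H) (Y :&: H) sH.
- exact: subsetIr.
- exact: subsetIr.
- by apply/set0Pn; exists x; rewrite inE xX.
- by apply/set0Pn; exists y; rewrite inE yY.
- apply: disjointWl (subsetIl _ _) _; exact: disjointWr (subsetIl _ _) dis.
- apply: leq_ltn_trans Sk; apply/subset_leq_card/subsetP=> v.
  rewrite !inE => /andP[+ vH]; rewrite vH !andbT; apply: contraR.
  exact: cov (in_setT _).
- rewrite !inE => /andP[aX _] /andP[bY _].
  by have := noarc _ _ aX bY; rewrite Eab.
Qed.

Lemma out_in_from (V : finType) (E : rel V) (A : {set V}) v :
  tourn E -> v \notin A -> out_in E A v + in_from E A v = #|A|.
Proof.
move=> [_ tot] vA; rewrite /out_in /in_from.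
rewrite -(cardsID [set u | E v u] A); congr (_ + _); apply: eq_card => u; rewrite !inE //.
rewrite andbC; case: (boolP (u \in A)) => uA //; rewrite ?andbF ?andbT //.
apply: tot; by apply: contra vA => /eqP <-.
Qed.

Lemma out_inS (V : finType) (E : rel V) (A B : {set V}) v :
  A \subset B -> out_in E A v <= out_in E B v.
Proof.
by move=> AB; apply/subset_leq_card/subsetP=> u; rewrite !inE => /andP[/(subsetP AB)-> ->].
Qed.

Lemma in_fromS (V : finType) (E : rel V) (A B : {set V}) v :
  A \subset B -> in_from E A v <= in_from E B v.
Proof. exact: (@out_inS _ (op_rel E)). Qed.

Lemma eq_out_in (V : finType) (E F : rel V) (A : {set V}) v w :
  (forall u, u \in A -> E v u = F w u) -> out_in E A v = out_in F A w.
Proof.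
by move=> EF; apply: eq_card => u; rewrite !inE; case: (boolP (u \in A)) => // /EF ->.
Qed.

Lemma eq_in_from (V : finType) (E F : rel V) (A : {set V}) v w :
  (forall u, u \in A -> E u v = F u w) -> in_from E A v = in_from F A w.
Proof. exact: (@eq_out_in _ (op_rel E) (op_rel F)). Qed.

(** With fewer than [k] out-neighbours in [H], [v] has at least [k] in-neighbours in each of [K1]
    and [K2]; those in [K1] become out-neighbours, those in [K2] stay. The other case is dual. *)
Lemma swap_half (V : finType) (E F : rel V) (H K1 K2 : {set V}) k v :
  tourn E -> v \notin H -> K1 \subset H -> K2 \subset H ->
  (2 * k).-1 <= #|K1| -> (2 * k).-1 <= #|K2| ->
  (forall h, h \in K1 -> F v h = E h v /\ F h v = E v h) ->
  (forall h, h \in K2 -> F v h = E v h /\ F h v = E h v) ->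
  (out_in E H v < k) || (in_from E H v < k) ->
  k <= out_in F H v /\ k <= in_from F H v.
Proof.
move=> tE vH K1H K2H c1 c2 F1 F2 bad.
have e1 := out_in_from tE (contra (subsetP K1H v) vH).
have e2 := out_in_from tE (contra (subsetP K2H v) vH).
have o1 : out_in F K1 v = in_from E K1 v.
  by apply: (@eq_out_in _ F (op_rel E)) => h /F1[].
have i1 : in_from F K1 v = out_in E K1 v.
  by apply: (@eq_out_in _ (op_rel F) E) => h /F1[].
have o2 : out_in F K2 v = out_in E K2 v by apply: eq_out_in => h /F2[].
have i2 : in_from F K2 v = in_from E K2 v by apply: eq_in_from => h /F2[].
have := (out_inS F v K1H, out_inS F v K2H, in_fromS F v K1H, in_fromS F v K2H).
have := (out_inS E v K1H, out_inS E v K2H, in_fromS E v K1H, in_fromS E v K2H).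
rewrite o1 i1 o2 i2; move=> [[[? ?] ?] ?] [[[? ?] ?] ?].
case/orP: bad => ?; lia.
Qed.

(** * Three inversions and strong cores *)

Definition flip3 (V : finType) (E : rel V) (X1 X2 X3 : {set V}) : rel V :=
  fun x y =>
    if ((x \in X1) && (y \in X1)) (+) ((x \in X2) && (y \in X2))
       (+) ((x \in X3) && (y \in X3)) then E y x else E x y.

Definition inv3 (V : finType) (E : rel V) k :=
  exists X1 X2 X3 : {set V}, cut_strong (flip3 E X1 X2 X3) setT k.

Lemma cut_strong_op (V : finType) (E : rel V) (H : {set V}) k :
  cut_strong E H k -> cut_strong (op_rel E) H k.
Proof.
move=> sE; apply/forallP=> X; apply/forallP=> Y; apply/implyP.
move=> /and5P[XH YH X0 Y0 /andP[dis small]].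
have [||y [x [yY xX Eyx]]] := cut_strongE sE YH XH Y0 X0.
- by rewrite disjoint_sym.
- by rewrite setUC.
- by apply/exists_inP; exists x => //; apply/exists_inP; exists y.
Qed.

Lemma eq_cut_strong (V : finType) (E F : rel V) (H : {set V}) k :
  E =2 F -> cut_strong E H k = cut_strong F H k.
Proof.
move=> EF; apply: eq_forallb => X; apply: eq_forallb => Y; congr (_ ==> _).
by apply: eq_existsb => x; congr (_ && _); apply: eq_existsb => y; rewrite EF.
Qed.

(** Inversions commute with reversal of all arcs, so an argument about sources also serves for
    sinks. *)
Lemma inv3_op (V : finType) (E : rel V) k : inv3 (op_rel E) k -> inv3 E k.
Proof.
move=> [X1 [X2 [X3 /cut_strong_op s]]]; exists X1, X2, X3.
rewrite -(eq_cut_strong _ _ (_ : op_rel (flip3 (op_rel E) X1 X2 X3) =2 _)) //.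
move=> x y; rewrite /op_rel /flip3; congr (if _ then _ else _).
by rewrite (andbC (y \in X1)) (andbC (y \in X2)) (andbC (y \in X3)).
Qed.

Lemma subset_card (V : finType) (A : {set V}) m :
  m <= #|A| -> exists2 B : {set V}, B \subset A & #|B| = m.
Proof.
move=> mA; exists [set x in take m (enum A)].
  by apply/subsetP=> x; rewrite inE => /mem_take; rewrite mem_enum.
rewrite cardsE; have /card_uniqP -> : uniq (take m (enum A)) by rewrite take_uniq ?enum_uniq.
by rewrite size_takel // -cardE.
Qed.

(* [K1] is inverted twice, so only its arcs to the bad vertices are reversed. *)
Lemma inv3_core (V : finType) (E : rel V) (K : {set V}) k :
  tourn E -> 0 < k -> 4 * k - 2 <= #|K| -> cut_strong E K k -> inv3 E k.
Proof.
move=> tE k0 cK sK.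
have [|K1 K1K cK1] := @subset_card _ K (2 * k).-1; first lia.
pose bad := [set v | (v \notin K) && ((out_in E K v < k) || (in_from E K v < k))].
exists (K1 :|: bad), K1, set0; set F := flip3 _ _ _ _.
have K1bad v : v \in K -> v \notin bad by move=> vK; rewrite inE vK.
have FK x y : x \in K -> y \in K -> F x y = E x y.
  move=> xK yK; rewrite /F /flip3 in_setU (negbTE (K1bad _ xK)) in_setU (negbTE (K1bad _ yK)).
  by rewrite !orbF addbb !inE.
apply: (@cut_strong_extend _ _ K).
  apply: cut_strongI => X Y S x0 y0 x0X y0Y Sk XK YK dis cov noarc.
  have [||||x [y [xX yY Exy]]] := cut_strongE sK XK YK.
  - by apply/set0Pn; exists x0.
  - by apply/set0Pn; exists y0.
  - by [].
  - apply: leq_ltn_trans Sk; apply/subset_leq_card/subsetP=> v.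
    rewrite !inE => /andP[+ vK]; apply: contraR; exact: cov.
  - have := noarc _ _ xX yY; rewrite FK ?Exy //; [exact: subsetP xX|exact: subsetP yY].
move=> v vK; have vK1 : v \notin K1 by apply: contra vK; exact: (subsetP K1K).
have [vbad|vgood] := boolP (v \in bad); last first.
  have FE h : F v h = E v h /\ F h v = E h v.
    by rewrite /F /flip3 !in_setU (negbTE vK1) (negbTE vgood) !in_set0 !andbF !andFb.
  rewrite (@eq_out_in _ F E K v v) ?(@eq_in_from _ F E K v v); first last.
  - by move=> h _; case: (FE h).
  - by move=> h _; case: (FE h).
  move: vgood; rewrite inE vK negb_or -!leqNgt; by case/andP.
apply: (@swap_half _ E F K K1 (K :\: K1)) => //.
- exact: subsetDl.
- by rewrite cK1.
- rewrite cardsD (setIidPr K1K) cK1; lia.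
- by move=> h hK1; rewrite /F /flip3 !in_setU (negbTE vK1) vbad hK1 !in_set0 /= ?andbF.
- move=> h; rewrite in_setD => /andP[hK1 hK].
  by rewrite /F /flip3 !in_setU (negbTE hK1) (negbTE (K1bad _ hK)) !in_set0 !andbF.
- by move: vbad; rewrite inE => /andP[].
Qed.

(** * The blown-up triangle *)

(** The score in the Gale-Berlekamp switching game: [f] switches rows and [g] switches columns. *)
Definition flip_weight (V : finType) (R : rel V) (B C : {set V}) (f g : {ffun V -> bool}) :=
  \sum_(b in B) #|[set c in C | R b c (+) f b (+) g c]|.

Lemma flip_weight_op (V : finType) (R : rel V) (B C : {set V}) f g :
  flip_weight R B C f g = flip_weight (op_rel R) C B g f.
Proof.
rewrite /flip_weight.
under eq_bigr => b _ do rewrite -sum1dep_card big_mkcondr /=.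
under [in RHS]eq_bigr => c _ do rewrite -sum1dep_card big_mkcondr /=.
rewrite exchange_big /=; apply: eq_bigr => c _; apply: eq_bigr => b _.
by rewrite /op_rel -!addbA (addbC (f b)).
Qed.

(** Switching row [b] alone turns its count r into |C| - r and leaves the other rows unchanged, so
    maximality gives |C| - r <= r. *)
Lemma flip_weight_row (V : finType) (R : rel V) (B C : {set V}) f g b :
  (forall f', flip_weight R B C f' g <= flip_weight R B C f g) -> b \in B ->
  #|C| <= 2 * #|[set c in C | R b c (+) f b (+) g c]|.
Proof.
move=> fmax bB; have := fmax [ffun x => f x (+) (x == b)].
rewrite /flip_weight (bigD1 b) //= [in leqRHS](bigD1 b) //=.
set r' := #|_|; set r := #|_|; set s' := \sum_(_ in _ | _) _; set s := \sum_(_ in _ | _) _.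
have -> : s' = s.
  apply: eq_bigr => x /andP[_ /negbTE xb]; apply: eq_card => c.
  by rewrite !inE ffunE xb addbF.
have -> : r' = #|C| - r.
  rewrite /r -(cardsID [set c | R b c (+) f b (+) g c] C).
  set I := _ :&: _; have -> : [set c in C | R b c (+) f b (+) g c] = I.
    by apply/setP=> c; rewrite !inE.
  rewrite addKn; apply: eq_card => c; rewrite !inE ffunE eqxx andbC.
  by case: (_ \in C); case: (R b c); case: (f b); case: (g c).
lia.
Qed.

Lemma flip_balance (V : finType) (R : rel V) (B C : {set V}) :
  exists f g : {ffun V -> bool},
    (forall b, b \in B -> #|C| <= 2 * #|[set c in C | R b c (+) f b (+) g c]|) /\
    (forall c, c \in C -> #|B| <= 2 * #|[set b in B | R b c (+) f b (+) g c]|).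
Proof.
pose W (p : {ffun V -> bool} * {ffun V -> bool}) := flip_weight R B C p.1 p.2.
pose p0 := ([ffun x : V => false], [ffun x : V => false]).
(* A joint maximum is a maximum in [f] and in [g] separately; columns are handled as rows of the
   transpose. *)
case: (@arg_maxnP _ p0 xpredT W isT) => -[f g] _ pmax; exists f, g; split=> [b bB|c cC].
  by apply: flip_weight_row bB => f'; exact: (pmax (f', g) isT).
rewrite (_ : [set b in B | _] = [set b in B | op_rel R c b (+) g c (+) f b]).
  by apply: flip_weight_row cC => g'; rewrite -!(flip_weight_op R B C); exact: (pmax (f, g') isT).
by apply/setP=> b; rewrite !inE /op_rel -!addbA (addbC (g c)).
Qed.

(** Parity is what makes 2k-1 vertices enough instead of 2k. *)
Lemma half_majority k m r : (2 * k).-1 <= m -> m <= 2 * r -> k <= r.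
Proof. lia. Qed.

(** Two subsets of an [a]-set, of sizes [a1] >= a - w and [a2] >= a - u, share at least a - u - w >=
    k elements, but their intersection has size [a12] <= s < k. *)
Lemma triangle_count k u w a oc ob a1 a2 a12 s :
  oc + a1 = a -> ob + a2 = a -> oc <= w -> ob <= u -> a12 <= s -> s < k ->
  u + w + k <= a -> a1 + a2 - a12 <= a -> False.
Proof. lia. Qed.

(* [E b c (+) f b (+) g c] tells whether [b -> c] after the switching; a vector
   [(f b, 1, 0)] on [B], [(1, g c, 1)] on [C] and [(0, 0, 1)] on [A] realises it
   while reversing all of [A x C] and none of [A x B].  A cut would need
   [c \in C] on the closed side and [b \in B] on the other one; the two
   neighbourhoods in [A] then meet outside the deleted set because
   [u + w + k <= #|A|]. *)
Lemma inv3_triangle (V : finType) (E : rel V) (A B C : {set V}) k u w :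
  tourn E -> 0 < k ->
  [disjoint A & B] -> [disjoint A & C] -> [disjoint B & C] ->
  (2 * k).-1 <= #|B| -> (2 * k).-1 <= #|C| ->
  (forall a, a \in A -> k <= out_in E B a) ->
  (forall a, a \in A -> k <= out_in E C a) ->
  (forall b, b \in B -> out_in E A b <= u) ->
  (forall c, c \in C -> out_in E A c <= w) ->
  u + w + k <= #|A| -> inv3 E k.
Proof.
move=> tE k0 AB AC BC cB cC rB rC colB colC uw.
have [irr tot] := tE.
have [f [g [frow gcol]]] := flip_balance E B C.
pose H := A :|: B :|: C.
pose bad := [set v | (v \notin H) && ((out_in E H v < k) || (in_from E H v < k))].
pose X1 := [set b in B | f b] :|: C.
pose X2 := B :|: [set c in C | g c].
pose X3 := A :|: C :|: bad.
exists X1, X2, X3; set F := flip3 _ _ _ _.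
have memA a : a \in A -> [/\ (a \in X1) = false, (a \in X2) = false, a \in X3 & a \in H].
  move=> aA; rewrite !inE aA (disjointFr AB aA) (disjointFr AC aA); by split.
have memB b : b \in B -> [/\ (b \in X1) = f b, b \in X2, (b \in X3) = false & b \in H].
  move=> bB; rewrite !inE bB (disjointFl AB bB) (disjointFr BC bB) orbF !orbT; by split.
have memC c : c \in C -> [/\ c \in X1, (c \in X2) = g c, c \in X3 & c \in H].
  move=> cC'; rewrite !inE cC' (disjointFl AC cC') (disjointFl BC cC') !orbT; by split.
have memO v : v \notin H -> [/\ (v \in X1) = false, (v \in X2) = false & (v \in X3) = (v \in bad)].
  rewrite /H !in_setU !negb_or -andbA => /and3P[vA vB vC].
  by split; rewrite !inE ?(negbTE vA) ?(negbTE vB) ?(negbTE vC).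
have FAB a b : a \in A -> b \in B -> F a b = E a b.
  by move=> /memA[a1 a2 a3 _] /memB[b1 b2 b3 _]; rewrite /F /flip3 a1 a2 b3 andbF.
have FCA c a : c \in C -> a \in A -> F c a = E a c.
  by move=> /memC[c1 c2 c3 _] /memA[a1 a2 a3 _]; rewrite /F /flip3 a1 a2 a3 c3 !andbF.
have FBC b c : b \in B -> c \in C -> F b c = E b c (+) f b (+) g c.
  move=> bB cC'; have bc : b != c by apply: contraTneq cC' => <-; rewrite (disjointFr BC bB).
  have [c1 c2 c3 _] := memC _ cC'; have [b1 b2 b3 _] := memB _ bB.
  rewrite /F /flip3 b1 b2 b3 c1 c2 andbT andTb andFb addbF -addbA.
  rewrite (tot _ _ bc); by case: (E c b); case: (f b (+) g c).
have AH : A \subset H by apply/subsetP=> a /memA[].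
have BH : B \subset H by apply/subsetP=> a /memB[].
have CH : C \subset H by apply/subsetP=> a /memC[].
apply: (@cut_strong_extend _ _ H).
  apply: cut_strongI => X Y S x0 y0 x0X y0Y Sk XH YH dis cov noarc.
  have fwd A' x := @cut_forward _ F H X Y S A' k x Sk.
  have bwd A' x := @cut_backward _ F H X Y S A' k x Sk.
  have hitBC x : x \in X -> x \in B -> exists2 c, c \in C & c \in X.
    move=> xX xB; apply: fwd xX _ => //.
    rewrite (@eq_out_in _ F (fun b c => E b c (+) f b (+) g c) C x x).
      exact: half_majority cC (frow _ xB).
    by move=> c; apply: FBC.
  have hitCB y : y \in Y -> y \in C -> exists2 b, b \in B & b \in Y.
    move=> yY yC; apply: bwd yY _ => //.
    rewrite (@eq_in_from _ F (fun b c => E b c (+) f b (+) g c) B y y).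
      exact: half_majority cB (gcol _ yC).
    by move=> b bB; apply: FBC.
  (* Forward steps along A -> B -> C keep to [X] and end in [C]; below, backward steps from [A] to
     [C] to [B] keep to [Y] and end in [B]. *)
  have [c cC' cX] : exists2 c, c \in C & c \in X.
    have := subsetP XH _ x0X; rewrite !in_setU -orbA => /or3P[x0A|x0B|x0C].
    - have [|b bB bX] := fwd B x0 BH cov noarc x0X; last exact: hitBC bX bB.
      by rewrite (@eq_out_in _ F E B x0 x0) ?rB // => b; apply: FAB.
    - exact: hitBC x0X x0B.
    - by exists x0.
  have [b bB bY] : exists2 b, b \in B & b \in Y.
    have := subsetP YH _ y0Y; rewrite !in_setU -orbA => /or3P[y0A|y0B|y0C].
    - have [|c' c'C c'Y] := bwd C y0 CH cov noarc y0Y; last exact: hitCB c'Y c'C.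
      rewrite (@eq_in_from _ F (op_rel E) C y0 y0) ?rC // => c' c'C; exact: FCA.
    - by exists y0.
    - exact: hitCB y0Y y0C.
  have e1 := out_in_from tE (negbT (disjointFl AC cC')).
  have e2 := out_in_from tE (negbT (disjointFl AB bB)).
  have := (colC _ cC', colB _ bB); move=> [w1 w2].
  set A1 := [set a in A | E a c]; set A2 := [set a in A | E a b].
  (* Such an [a] has the arcs c -> a -> b in [F], so it lies neither in [Y] nor in [X]. *)
  have A12 : #|A1 :&: A2| <= #|S|.
    apply/subset_leq_card/subsetP=> a; rewrite !inE => /andP[/andP[aA Eac] /andP[_ Eab]].
    apply: contraT => aS; have := cov _ (subsetP AH _ aA) aS; case/orP=> [aX|aY].
      by have := noarc _ _ aX bY; rewrite FAB ?Eab.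
    by have := noarc _ _ cX aY; rewrite FCA ?Eac.
  have : #|A1 :|: A2| <= #|A|.
    by apply/subset_leq_card/subsetP=> a; rewrite !inE => /orP[] /andP[].
  rewrite cardsU => A12'; exact: triangle_count e1 e2 w1 w2 A12 Sk uw A12'.
(* A bad vertex has the vector (0, 0, 1): its arcs to [C] are reversed and those to [B] are kept.
   Every other vertex outside [H] has the zero vector. *)
move=> v vH; have [v1 v2 v3] := memO _ vH.
have [vbad|vgood] := boolP (v \in bad); last first.
  have FE h : F v h = E v h /\ F h v = E h v.
    by rewrite /F /flip3 v1 v2 v3 (negbTE vgood) !andbF !andFb.
  rewrite (@eq_out_in _ F E H v v) ?(@eq_in_from _ F E H v v); first last.
  - by move=> h _; case: (FE h).
  - by move=> h _; case: (FE h).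
  move: vgood; rewrite inE vH negb_or -!leqNgt; by case/andP.
apply: (@swap_half _ E F H C B) => //.
- by move=> h /memC[h1 h2 h3 _]; rewrite /F /flip3 v1 v2 v3 vbad h3 !andbF.
- by move=> h /memB[h1 h2 h3 _]; rewrite /F /flip3 v1 v2 v3 h3 !andbF.
- by move: vbad; rewrite inE => /andP[].
Qed.

(** * Peeling off sources and sinks *)

(** A vertex counted in both terms contributes u + d, which its own [x v] covers. *)
Lemma sum_two_levels (V : finType) (K : {set V}) (x : V -> nat) u d :
  #|[set v in K | u <= x v]| * u + #|[set v in K | u + d <= x v]| * d
    <= \sum_(v in K) x v.
Proof.
rewrite -!sum1dep_card !big_distrl /= !big_mkcondr -big_split /=.
apply: leq_sum => v _; case: ifP; case: ifP; lia.
Qed.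

Lemma card_le_gt (V : finType) (K : {set V}) (x : V -> nat) m :
  #|[set v in K | x v <= m]| + #|[set v in K | m < x v]| = #|K|.
Proof.
rewrite -(cardsID [set v | x v <= m] K); congr (_ + _).
  by apply: eq_card => v; rewrite !inE.
by apply: eq_card => v; rewrite !inE ltnNge andbC.
Qed.

(** The hypotheses give t >= k, hence a < 2t, and then a(k-1) is below (2k+1)t. *)
Lemma column_count k a t s :
  0 < k -> (2 * k).-1 <= a -> a = t + k.-1 -> s <= a * k.-1 -> (2 * k).+1 * t <= s ->
  False.
Proof.
case: k => // k _; rewrite /= => a1 a2; have tk : k < t by lia.
rewrite a2; nia.
Qed.

(* [B] takes the columns with the fewest exceptions and [C] the next ones; the
   bounds [u] and [w] have to differ, a common bound would need a larger [K]. *)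
Lemma column_choice (V : finType) (K : {set V}) (x : V -> nat) k a :
  0 < k -> (2 * k).-1 <= a -> 6 * k <= #|K| -> \sum_(v in K) x v <= a * k.-1 ->
  exists (B C : {set V}) (u w : nat),
    [/\ B \subset K, C \subset K & [disjoint B & C]] /\
    [/\ #|B| = (2 * k).-1, #|C| = (2 * k).-1, u + w + k <= a,
        forall b, b \in B -> x b <= u & forall c, c \in C -> x c <= w].
Proof.
move=> k0 a2k cK sum_le.
have exm : exists m, (2 * k).-1 <= #|[set v in K | x v <= m]|.
  exists (\sum_(v in K) x v).
  rewrite (_ : [set v in K | _] = K); first lia.
  apply/setP=> v; rewrite !inE; case: (boolP (v \in K)) => // vK.
  by rewrite (bigD1 v) //= leq_addr.
case: (ex_minnP exm) => u cu umin.
have [B BU cB] := subset_card cu.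
have Bu b : b \in B -> x b <= u by move=> /(subsetP BU); rewrite inE => /andP[].
have BK : B \subset K by apply/subsetP=> b /(subsetP BU); rewrite inE => /andP[].
(* Minimality of [u]: at most 2k-2 columns lie below it. *)
have low : #|K| - (2 * k).-2 <= #|[set v in K | u <= x v]|.
  case: (posnP u) => [->|u0].
    rewrite (_ : [set v in K | _] = K); first lia.
    by apply/setP=> v; rewrite !inE andbT.
  have := card_le_gt K x u.-1; rewrite prednK //.
  have : ~~ ((2 * k).-1 <= #|[set v in K | x v <= u.-1]|).
    by apply/negP=> /umin; lia.
  lia.
have t0 : a = (a - k.-1) + k.-1 by lia.
(* If 2u >= a-k+1, the at least 4k+2 columns of value at least [u] sum to at least (2k+1)(a-k+1),
   too much. Otherwise the largest admissible [w] is at least [u]. *)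
have [ua|ua] := leqP (2 * u) (a - k); last first.
  exfalso; apply: (column_count k0 a2k t0 sum_le).
  apply: leq_trans (sum_two_levels K x u 0); rewrite muln0 addn0.
  apply: leq_trans (leq_mul low (leqnn u)).
  have : 4 * k + 2 <= #|K| - (2 * k).-2 by lia.
  have : a - k.-1 <= 2 * u by lia.
  move: (a - k.-1) (#|K| - (2 * k).-2) => t q; nia.
pose w := a - k - u.
(* Room for [B] and [C] together. Failing this, the sum is at least (4k+2)u + (2k+1)(w+1-u) =
   (2k+1)(a-k+1). *)
have cG : 4 * k - 2 <= #|[set v in K | x v <= w]|.
  rewrite leqNgt; apply/negP=> cG; apply: (column_count k0 a2k t0 sum_le).
  have high : #|K| - (4 * k - 3) <= #|[set v in K | u + (w.+1 - u) <= x v]|.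
    have := card_le_gt K x w; rewrite (_ : u + (w.+1 - u) = w.+1); last by rewrite /w; lia.
    lia.
  apply: leq_trans (sum_two_levels K x u (w.+1 - u)).
  apply: leq_trans (leq_add (leq_mul low (leqnn u)) (leq_mul high (leqnn _))).
  have -> : a - k.-1 = 2 * u + (w.+1 - u) by rewrite /w; lia.
  have : 4 * k + 2 <= #|K| - (2 * k).-2 by lia.
  have : 2 * k + 1 <= #|K| - (4 * k - 3) by lia.
  move=> r_ge q_ge; rewrite mulnDr mulnA leq_add // leq_mul2r; apply/orP; right; lia.
have [|C CG cC] := @subset_card _ ([set v in K | x v <= w] :\: B) (2 * k).-1.
  have := cardsID B [set v in K | x v <= w].
  have := subset_leq_card (subsetIr [set v in K | x v <= w] B); lia.
exists B, C, u, w; split; split=> //.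
- by apply/subsetP=> c /(subsetP CG); rewrite !inE => /and3P[].
- apply/pred0P=> c /=; apply/negbTE/negP=> /andP[cB' /(subsetP CG)].
  by rewrite !inE cB'.
- rewrite /w; lia.
- by move=> c /(subsetP CG); rewrite !inE => /and3P[].
Qed.

Lemma sum_out_in (V : finType) (E : rel V) (A K : {set V}) :
  \sum_(v in K) out_in E A v = \sum_(a in A) in_from E K a.
Proof.
rewrite /out_in /in_from.
under eq_bigr => v _ do rewrite -sum1dep_card big_mkcondr /=.
under [in RHS]eq_bigr => a _ do rewrite -sum1dep_card big_mkcondr /=.
by rewrite exchange_big.
Qed.

(** At most |A|(k-1) arcs go from [K] to [A], so [column_choice] applies. Any 2k-1 vertices of [K]
    keep at least [k] out-neighbours of each [a]. *)
Lemma inv3_sources (V : finType) (E : rel V) (A K : {set V}) k :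
  tourn E -> 0 < k -> [disjoint A & K] -> (2 * k).-1 <= #|A| -> 6 * k <= #|K| ->
  (forall a, a \in A -> in_from E K a < k) -> inv3 E k.
Proof.
move=> tE k0 AK cA cK few.
have [|B [C [u [w [[BK CK BC] [cB cC uw Bu Cw]]]]]] :=
    @column_choice _ K (out_in E A) k #|A| k0 cA cK.
  rewrite sum_out_in -sum_nat_const; apply: leq_sum => a /few; lia.
have row (D : {set V}) a : D \subset K -> #|D| = (2 * k).-1 -> a \in A -> k <= out_in E D a.
  move=> DK cD aA; have aD : a \notin D.
    by apply: contraTN aA => /(subsetP DK) aK; rewrite (disjointFl AK).
  have := out_in_from tE aD; have := in_fromS E a DK; have := few _ aA; lia.
apply: (@inv3_triangle _ E A B C k u w) => //; rewrite ?cB ?cC //.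
- exact: disjointWr BK AK.
- exact: disjointWr CK AK.
- by move=> a; apply: row.
- by move=> a; apply: row.
Qed.

(** * Triangles from completely joined pairs *)

Lemma out_in_full (V : finType) (E : rel V) (R : {set V}) v :
  (forall y, y \in R -> E v y) -> out_in E R v = #|R|.
Proof.
by move=> full; apply: eq_card => y; rewrite !inE; case: (boolP (y \in R)) => // /full.
Qed.

Lemma out_in_empty (V : finType) (E : rel V) (L R : {set V}) v :
  tourn E -> [disjoint L & R] -> (forall x y, x \in L -> y \in R -> E x y) -> v \in R ->
  out_in E L v = 0.
Proof.
move=> [_ tot] LR full vR; apply: eq_card0 => x; rewrite !inE; apply/negbTE/negP=> /andP[xL].
rewrite tot ?full //; apply: contraTneq vR => ->; by rewrite (disjointFr LR xL).
Qed.

(** No arc returns from [R] to [L], so u = w = 0 and [k] vertices in [L] suffice; [B] and [C] are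
    both taken from [R]. *)
Lemma inv3_complete (V : finType) (E : rel V) (L R : {set V}) k :
  tourn E -> 0 < k -> [disjoint L & R] -> (forall x y, x \in L -> y \in R -> E x y) ->
  k <= #|L| -> 4 * k - 2 <= #|R| -> inv3 E k.
Proof.
move=> tE k0 LR full cL cR.
have [|B BR cB] := @subset_card _ R (2 * k).-1; first lia.
have [|C CR cC] := @subset_card _ (R :\: B) (2 * k).-1.
  rewrite cardsD (setIidPr BR); lia.
have CR' : C \subset R := subset_trans CR (subsetDl _ _).
apply: (@inv3_triangle _ E L B C k 0 0) => //; rewrite ?cB ?cC //.
- exact: disjointWr BR LR.
- exact: disjointWr CR' LR.
- rewrite disjoint_sym; apply: disjointWl CR _; by rewrite disjoints_subset setDE subsetIr.
- move=> a aL; rewrite out_in_full ?cB; first lia.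
  by move=> b /(subsetP BR); apply: full.
- move=> a aL; rewrite out_in_full ?cC; first lia.
  by move=> b /(subsetP CR'); apply: full.
- by move=> b /(subsetP BR) bR; rewrite (out_in_empty tE LR full bR).
- by move=> b /(subsetP CR') bR; rewrite (out_in_empty tE LR full bR).
Qed.

Lemma disjoint_setUl (V : finType) (A B C : {set V}) :
  [disjoint A & C] -> [disjoint B & C] -> [disjoint A :|: B & C].
Proof. by rewrite -!setI_eq0 setIUl => /eqP-> /eqP->; rewrite setU0. Qed.

(** Here [C] consists of [k] vertices of [R], which already give the out-neighbours needed, and k-1
    sinks. The sinks raise [w] to k-1, paid for by |L| >= 2k-1. *)
Lemma inv3_complete_sinks (V : finType) (E : rel V) (L R Z : {set V}) k :
  tourn E -> 0 < k -> [disjoint L & R] -> [disjoint L & Z] -> [disjoint R & Z] ->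
  (forall x y, x \in L -> y \in R -> E x y) ->
  (forall z, z \in Z -> out_in E L z < k) ->
  (2 * k).-1 <= #|L| -> 3 * k - 1 <= #|R| -> k.-1 <= #|Z| -> inv3 E k.
Proof.
move=> tE k0 LR LZ RZ full few cL cR cZ.
have [|B BR cB] := @subset_card _ R (2 * k).-1; first lia.
have [|C1 CR cC1] := @subset_card _ (R :\: B) k.
  rewrite cardsD (setIidPr BR); lia.
have C1R : C1 \subset R := subset_trans CR (subsetDl _ _).
have [C2 C2Z cC2] := subset_card cZ.
apply: (@inv3_triangle _ E L B (C1 :|: C2) k 0 k.-1) => //.
- exact: disjointWr BR LR.
- rewrite disjoint_sym disjoint_setUl // disjoint_sym; [exact: disjointWr C1R LR|exact: disjointWr C2Z LZ].
- rewrite disjoint_sym disjoint_setUl //.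
    by apply: disjointWl CR _; rewrite disjoints_subset setDE subsetIr.
  rewrite disjoint_sym; apply: disjointWl BR _; exact: disjointWr C2Z RZ.
- by rewrite cB.
- have : [disjoint C1 & C2] by apply: disjointWl C1R _; exact: disjointWr C2Z RZ.
  rewrite -setI_eq0 => /eqP C12; rewrite cardsU C12 cards0; lia.
- move=> a aL; rewrite out_in_full ?cB; first lia.
  by move=> b /(subsetP BR); apply: full.
- move=> a aL; apply: leq_trans (out_inS E a (subsetUl C1 C2)).
  rewrite out_in_full ?cC1 // => b /(subsetP C1R); exact: full.
- by move=> b /(subsetP BR) bR; rewrite (out_in_empty tE LR full bR).
- move=> c; rewrite in_setU => /orP[/(subsetP C1R) cR'|/(subsetP C2Z)/few]; last lia.
  by rewrite (out_in_empty tE LR full cR').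
- lia.
Qed.

(** [A] holds the removed sources and [Z] the removed sinks. Degrees are counted in the current [K],
    so the bounds survive when [K] shrinks. *)
Definition peeled (V : finType) (E : rel V) k (A Z K : {set V}) :=
  [/\ [disjoint A & K], [disjoint Z & K], A :|: Z :|: K = setT,
      forall a, a \in A -> in_from E K a < k & forall z, z \in Z -> out_in E K z < k].

Lemma peeled_op (V : finType) (E : rel V) k A Z K :
  peeled E k A Z K -> peeled (op_rel E) k Z A K.
Proof. by move=> [AK ZK cov a z]; split=> //; rewrite (setUC Z). Qed.

Lemma peeled_card (V : finType) (E : rel V) k A Z K :
  peeled E k A Z K -> #|V| <= #|A| + #|Z| + #|K|.
Proof.
move=> [_ _ cov _ _]; rewrite -cardsT -cov !cardsU.
by rewrite (leq_trans (leq_subr _ _)) // leq_add2r leq_subr.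
Qed.

(** An in-neighbour in [K :\: L] of a vertex of [L] cannot lie in [R], hence is among the fewer than
    [k] vertices outside both parts. *)
Lemma peel_sources (V : finType) (E : rel V) k (A Z K L R : {set V}) :
  tourn E -> peeled E k A Z K -> L \subset K -> R \subset K -> [disjoint L & R] ->
  #|K :\: (L :|: R)| < k -> (forall x y, x \in L -> y \in R -> E x y) ->
  peeled E k (A :|: L) Z (K :\: L).
Proof.
move=> tE [AK ZK cov inA outZ] LK RK LR small full; split.
- rewrite disjoint_setUl //; first exact: disjointWr (subsetDl _ _) AK.
  by rewrite disjoint_sym disjoints_subset setDE subsetIr.
- exact: disjointWr (subsetDl _ _) ZK.
- rewrite -cov; apply/setP=> v; rewrite !inE.
  have := subsetP LK v; case: (v \in L); case: (v \in A); case: (v \in Z); case: (v \in K) => //.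
  by move/(_ isT).
- move=> a; rewrite in_setU => /orP[aA|aL].
    exact: leq_ltn_trans (in_fromS E a (subsetDl K L)) (inA _ aA).
  apply: leq_ltn_trans small; apply/subset_leq_card/subsetP=> v.
  rewrite !inE => /andP[/andP[vL vK] Eva]; rewrite vK (negbTE vL) andbT /=.
  apply/negP=> vR; have [_ tot] := tE.
  by have := full _ _ aL vR; rewrite tot ?Eva //; apply: contraTneq aL => ->.
- by move=> z zZ; exact: leq_ltn_trans (out_inS E z (subsetDl K L)) (outZ _ zZ).
Qed.

Lemma inv3_peel (V : finType) (E : rel V) k (A Z K : {set V}) :
  0 < k -> 11 * k - 2 <= #|V| -> tourn E -> peeled E k A Z K ->
  #|A| <= (2 * k).-2 -> #|Z| <= (2 * k).-2 -> inv3 E k.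
Proof.
move=> k0 nV; have [m] := ubnP #|K|.
elim: m E A Z K => // m IH E A Z K cKm tE pE cA cZ.
have cV := peeled_card pE.
have [sK|/cut_not_strong[R [L [RK LK R0 L0 [RL small noarc]]]]] := boolP (cut_strong E K k).
  by apply: inv3_core sK => //; lia.
have LR : [disjoint L & R] by rewrite disjoint_sym.
have full x y : x \in L -> y \in R -> E x y.
  move=> xL yR; have [_ ->] := tE; first exact: noarc.
  by apply: contraTneq yR => <-; rewrite (disjointFr LR xL).
have small' : #|K :\: (L :|: R)| < k by rewrite setUC.
(* Stated for any [E'] so that it also removes sinks, through [op_rel]. When the sources reach 2k-1,
   at least (11k-2) - 2(2k-2) - (k-1) = 6k+3 vertices remain. *)
have step (E' : rel V) (A' Z' L' R' : {set V}) : tourn E' -> peeled E' k A' Z' K ->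
    #|A'| <= (2 * k).-2 -> #|Z'| <= (2 * k).-2 -> L' \subset K -> R' \subset K ->
    L' != set0 -> [disjoint L' & R'] -> #|K :\: (L' :|: R')| < k ->
    (forall x y, x \in L' -> y \in R' -> E' x y) -> #|L'| < k -> inv3 E' k.
  move=> tE' pE' cA' cZ' LK' RK' L0' LR' sm full' cL'.
  have pN := peel_sources tE' pE' LK' RK' LR' sm full'.
  have cKL : #|K :\: L'| = #|K| - #|L'| by rewrite cardsD (setIidPr LK').
  have cV' := peeled_card pE'.
  have L'0 : 0 < #|L'| by rewrite card_gt0.
  have L'K := subset_leq_card LK'.
  have [big|sml] := leqP (2 * k).-1 #|A' :|: L'|.
    have [AK _ _ inA _] := pN; apply: inv3_sources AK big _ inA => //.
    by clear - k0 nV cV' cA' cZ' cL' cKL; lia.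
  apply: IH pN _ cZ' => //; first by clear - cKm cKL L'0 L'K; lia.
  by clear - sml; lia.
have [cL|cL] := ltnP #|L| k; first exact: (step E A Z L R).
have [cR|cR] := ltnP #|R| k.
  apply: inv3_op; apply: (step _ Z A R L) => //.
  - exact: tourn_op.
  - exact: peeled_op.
  - by move=> x y xR yL; apply: full.
have [cR4|cR4] := leqP (4 * k - 2) #|R|; first exact: (inv3_complete tE k0 LR full).
have [cL4|cL4] := leqP (4 * k - 2) #|L|.
  apply: inv3_op; apply: (inv3_complete (tourn_op tE) k0 RL) => //.
  by move=> x y xR yL; apply: full.
have cLR : #|K| - k.-1 <= #|L| + #|R|.
  have : #|K :\: (L :|: R)| = #|K| - (#|L| + #|R|).
    rewrite cardsD (setIidPr _) ?subUset ?LK ?RK // cardsU.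
    by move: LR; rewrite -setI_eq0 => /eqP->; rewrite cards0 subn0.
  lia.
have [AK ZK _ inA outZ] := pE.
(* Now |K| >= 7k+2 and both parts have at most 4k-3 vertices. If |R| <= 3k-2, then |L| >= 3k+5, |K|
   <= 8k-6 and |A| >= k+6. If |Z| <= k-2, then |K| >= 8k+2, so |L| >= 3k+6, while |K| <= 9k-7 gives
   |A| >= k+7. Either way the dual case applies. *)
have [/andP[cR3 cZ1]|other] := boolP ((3 * k - 1 <= #|R|) && (k.-1 <= #|Z|)).
  apply: (inv3_complete_sinks tE k0 LR _ _ full _ _ cR3 cZ1).
  - by rewrite disjoint_sym; exact: disjointWr LK ZK.
  - by rewrite disjoint_sym; exact: disjointWr RK ZK.
  - move=> z zZ; exact: leq_ltn_trans (out_inS E z LK) (outZ _ zZ).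
  - lia.
apply: inv3_op; apply: (@inv3_complete_sinks _ _ R L A k (tourn_op tE) k0 RL).
- by rewrite disjoint_sym; exact: disjointWr RK AK.
- by rewrite disjoint_sym; exact: disjointWr LK AK.
- by move=> x y xR yL; apply: full.
- move=> a aA; exact: leq_ltn_trans (in_fromS E a RK) (inA _ aA).
- by lia.
- by lia.
- by lia.
Qed.

Lemma inv3_large (V : finType) (E : rel V) k :
  0 < k -> 11 * k - 2 <= #|V| -> tourn E -> inv3 E k.
Proof.
move=> k0 nV tE; apply: (@inv3_peel _ E k set0 set0 setT) => //; rewrite ?cards0 //.
split=> [|||a|a]; rewrite ?in_set0 ?set0U //; apply/pred0P=> v; by rewrite /= in_set0.
Qed.

(** * Digraphs on ordinals *)

Definition arc_rel n (D : digraph n) : rel 'I_n := fun x y => D (x, y).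

Lemma tourn_arc_rel n (D : digraph n) : is_tournament D -> tourn (arc_rel D).
Proof.
move=> /andP[/forallP irr /forallP tot]; split=> [x|x y xy]; first exact/negbTE/irr.
have /forallP/(_ y)/implyP/(_ xy) := tot x; rewrite /arc_rel.
by case: (D (x, y)); case: (D (y, x)).
Qed.

(** If [y] is unreachable from [x] after deleting [S], the reachable set and the remaining undeleted
    vertices form a cut without arcs. *)
Lemma cut_strong_vertex n (D : digraph n) k :
  k < n -> cut_strong (arc_rel D) setT k -> vertex_strong k D.
Proof.
move=> kn sD; rewrite /vertex_strong kn; apply/forallP=> S; apply/implyP=> Sk.
apply/forallP=> x; apply/forallP=> y; apply/implyP=> /andP[xS yS].
set e := [rel u v | _]; apply: contraT => nxy.
pose X := [set v | connect e x v]; pose Y := ~: (X :|: S).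
have XS v : v \in X -> v \notin S.
  rewrite inE => /connectP[p pp ->]; elim/last_ind: p pp => //= p w _.
  by rewrite rcons_path last_rcons => /andP[_ /= /andP[/andP[]]].
have [||||||a [b [aX]]] := @cut_strongE _ _ _ _ X Y sD; rewrite ?subsetT //.
- by apply/set0Pn; exists x; rewrite inE connect0.
- by apply/set0Pn; exists y; rewrite !inE negb_or nxy.
- by rewrite disjoints_subset setCK subsetUl.
- apply: leq_ltn_trans Sk; apply/subset_leq_card/subsetP=> v.
  by rewrite /Y !inE; case: (connect e x v); case: (v \in S).
- rewrite /Y !inE negb_or => /andP[/negP bX bS] ab; case: bX.
  have := aX; rewrite inE => /connect_trans; apply; apply: connect1.
  by rewrite /= XS // bS.
Qed.

Lemma invertE n (D : digraph n) X x y :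
  invert D X (x, y) = if (x \in X) && (y \in X) then D (y, x) else D (x, y).
Proof. by rewrite ffunE. Qed.

Lemma invert_seq3 n (D : digraph n) X1 X2 X3 :
  arc_rel (invert_seq D [:: X1; X2; X3]) =2 flip3 (arc_rel D) X1 X2 X3.
Proof.
move=> x y; rewrite /arc_rel /flip3 /= !invertE.
rewrite !(andbC (y \in _)).
by case: (_ && (y \in X1)); case: (_ && (y \in X2)); case: (_ && (y \in X3)).
Qed.

Lemma inv_reach3 n (T : digraph n) k :
  0 < k -> 11 * k - 2 <= n -> is_tournament T -> inv_reach (vertex_strong k) T 3.
Proof.
move=> k0 kn /tourn_arc_rel tT.
have [|X1 [X2 [X3 sX]]] := @inv3_large _ _ k k0 _ tT; first by rewrite card_ord.
apply/existsP; exists [tuple X1; X2; X3]; apply: cut_strong_vertex; first lia.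
by rewrite (eq_cut_strong _ _ (invert_seq3 T X1 X2 X3)).
Qed.

(** Whitney's argument: if fewer than [k] arcs leave [V1], deleting one suitable end of each
    separates some [x] in [V1] from some [y] outside. *)
Lemma vertex_arc_strong n k (D : digraph n) : vertex_strong k D -> arc_strong k D.
Proof.
move=> /andP[kn /forallP vs]; apply/forallP=> V1; apply/implyP=> /andP[V10 V20].
set F := [set p | _]; rewrite leqNgt; apply/negP=> Fk.
(* There are at least n-1 >= k pairs across the partition, so not all of them are arcs. *)
have [x xV [y yV Dxy]] : exists2 x, x \in V1 & exists2 y, y \in ~: V1 & ~~ D (x, y).
  have [/existsP[p /and3P[p1 p2 p3]]|allarc] :=
      boolP [exists p, [&& p.1 \in V1, p.2 \in ~: V1 & ~~ D p]].
    by exists p.1 => //; exists p.2; rewrite // -surjective_pairing.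
  have cF : #|setX V1 (~: V1)| <= #|F|.
    apply/subset_leq_card/subsetP=> p; rewrite !inE => /andP[p1 p2]; rewrite p1 p2 /=.
    apply: contraR allarc => np; apply/existsP; exists p; by rewrite p1 inE p2.
  move: cF Fk (cardsC V1) V10 V20; rewrite cardsX -!card_gt0 card_ord; nia.
(* [S] covers every arc leaving [V1] without containing [x] or [y]. *)
pose S := [set if p.1 == x then p.2 else p.1 | p in F].
have Sk : #|S| < k by apply: leq_ltn_trans (leq_imset_card _ _) Fk.
have /implyP/(_ Sk)/forallP/(_ x)/forallP/(_ y)/implyP := vs S.
have xS : x \notin S.
  apply/imsetP=> -[p]; rewrite !inE => /andP[/andP[p1 p2] _].
  case: eqP => [_ e|ne e]; last by case: ne.
  by rewrite -e xV in p2.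
have yS : y \notin S.
  apply/imsetP=> -[p]; rewrite !inE => /andP[/andP[p1 p2] Dp].
  case: eqP => [e1 e2|_ e]; last by move: yV; rewrite inE e p1.
  by move: Dxy; rewrite e2 -e1 -surjective_pairing Dp.
rewrite xS yS => /(_ isT)/connectP[p pp ye].
suff : y \in V1 by move: yV; rewrite inE => /negP.
rewrite ye; elim/last_ind: p pp {ye} => //= p w IH.
rewrite rcons_path last_rcons /= => /andP[/IH lV /andP[/andP[lS wS] Dlw]].
apply: contraT => wV; set l := last x p in lV lS Dlw.
have lwF : (l, w) \in F by rewrite !inE /= lV wV.
have : (if l == x then w else l) \in S by apply/imsetP; exists (l, w).
by case: ifP => _; rewrite ?(negbTE wS) ?(negbTE lS).
Qed.

(** * Every tournament can be made k-strong *)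

Lemma invert_tournament n (D : digraph n) X : is_tournament D -> is_tournament (invert D X).
Proof.
move=> /andP[/forallP irr /forallP tot]; apply/andP; split; apply/forallP=> x.
  by rewrite invertE if_same.
apply/forallP=> y; apply/implyP=> xy; have /forallP/(_ y)/implyP/(_ xy) := tot x.
by rewrite !invertE (andbC (y \in X)); case: ifP => //; rewrite addbC.
Qed.

(** Inverting a two-element set reverses a single arc, so the disagreements can be removed one at a
    time. *)
Lemma invert_seq_onto n (T D : digraph n) :
  is_tournament T -> is_tournament D -> exists s, invert_seq T s = D.
Proof.
have [m] := ubnP #|[set p | T p != D p]|; elim: m T => // m IH T cm tT tD.
have [/eqP d0|/set0Pn[[x y]]] := boolP ([set p | T p != D p] == set0).
  exists [::] => /=; apply/ffunP=> p; apply/eqP; apply: contraT => np.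
  by have := in_set0 p; rewrite -d0 inE np.
rewrite inE => dxy; have [irrT totT] := tourn_arc_rel tT.
have [irrD totD] := tourn_arc_rel tD.
have xy : x != y.
  by apply: contraNneq dxy => <-; rewrite -[T _]/(arc_rel T x x) -[D _]/(arc_rel D x x) irrT irrD.
have eT := totT _ _ xy; have eD := totD _ _ xy; rewrite /arc_rel in eT eD.
have less : #|[set p | invert T [set x; y] p != D p]| < #|[set p | T p != D p]|.
  apply/proper_card/properP; split; last first.
    exists (x, y); rewrite inE // invertE !inE !eqxx orbT /=.
    by move: dxy; rewrite eT; case: (T (y, x)); case: (D (x, y)).
  apply/subsetP=> -[u v]; rewrite !inE invertE !inE.
  case: ifP => // /andP[/orP[]/eqP-> /orP[]/eqP->] // _.
  by move: dxy; rewrite eT eD; case: (T (y, x)); case: (D (y, x)).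
have [||s sE] := IH (invert T [set x; y]) _ _ tD; last by exists ([set x; y] :: s).
  exact: leq_trans less cm.
exact: invert_tournament.
Qed.

Definition cyc_dist n (i j : 'I_n) : nat := if i <= j then j - i else n + j - i.

(** An explicit k-strong target: each vertex dominates the next [k] in cyclic order, and pairs
    farther apart both ways round are oriented by their labels. *)
Definition circulant n k : digraph n :=
  [ffun p : 'I_n * 'I_n => let d := cyc_dist p.1 p.2 in
     (0 < d <= k) || [&& k < d, d < n - k & p.1 < p.2]].

Lemma circulant_tournament n k : (2 * k).+1 <= n -> is_tournament (circulant n k).
Proof.
move=> kn; apply/andP; split; apply/forallP=> x.
  by rewrite ffunE /cyc_dist /= leqnn subnn.
apply/forallP=> y; apply/implyP=> xy; rewrite !ffunE /cyc_dist /=.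
have := (ltn_ord x, ltn_ord y); have : x != y :> nat by [].
move: (nat_of_ord x) (nat_of_ord y) => a b; case: (ltngtP a b) => // ab _ [] an bn; lia.
Qed.

(* For a pair [x \in X], [y \in Y] at minimal cyclic distance all vertices in
   between are deleted, so the distance is at most [k] and [x -> y]. *)
Lemma circulant_strong n k : (2 * k).+1 <= n -> cut_strong (arc_rel (circulant n k)) setT k.
Proof.
move=> kn; apply: cut_strongI => X Y S x0 y0 x0X y0Y Sk _ _ dis cov noarc.
pose good (p : 'I_n * 'I_n) := (p.1 \in X) && (p.2 \in Y).
have g0 : good (x0, y0) by rewrite /good x0X.
case: (@arg_minnP _ (x0, y0) good (fun p => cyc_dist p.1 p.2) g0).
move=> [x y] /andP[/= xX yY] dmin; set d := cyc_dist x y in dmin.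
have xy : x != y :> nat.
  by apply: contraTneq yY => /ord_inj <-; rewrite (disjointFr dis xX).
have := (ltn_ord x, ltn_ord y) => -[xn yn].
have d0 : 0 < d by rewrite /d /cyc_dist; case: (leqP x y); lia.
have dn : d < n by rewrite /d /cyc_dist; case: (leqP x y); lia.
have ck : d.-1 <= #|S|.
  have nn (i : 'I_d.-1) : (if x + i.+1 < n then x + i.+1 else x + i.+1 - n) < n.
    have := ltn_ord i; case: ifP; lia.
  pose h (i : 'I_d.-1) := Ordinal (nn i).
  have hinj : injective h.
    move=> i j /(congr1 val) /= e; apply: ord_inj; have := (ltn_ord i, ltn_ord j) => -[].
    by move: e; case: ifP; case: ifP; lia.
  apply: leq_trans (_ : #|[set h i | i : 'I_d.-1]| <= _).
    by rewrite card_imset // card_ord.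
  apply/subset_leq_card/subsetP=> _ /imsetP[i _ ->].
  have id := ltn_ord i; have dE : d = if x <= y then y - x else n + y - x by [].
  have hE : h i = (if x + i.+1 < n then x + i.+1 else x + i.+1 - n) :> nat by [].
  (* A vertex strictly between [x] and [y] would form a closer pair, with [y] if it is in [X], with
     [x] if it is in [Y]. *)
  apply: contraT => /(cov _ (in_setT _))/orP[hX|hY].
    have := dmin (h i, y); rewrite /good /= hX yY => /(_ isT).
    rewrite /cyc_dist hE; clear - id dE xn yn d0.
    move: (nat_of_ord i) (nat_of_ord x) (nat_of_ord y) id dE xn yn => j a b.
    case: (leqP a b) => ?; case: (ltnP (a + j.+1) n) => ?;
      [case: (leqP (a + j.+1) b) => ?|case: (leqP (a + j.+1 - n) b) => ?
      |case: (leqP (a + j.+1) b) => ?|case: (leqP (a + j.+1 - n) b) => ?]; lia.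
  have := dmin (x, h i); rewrite /good /= hY xX => /(_ isT).
  rewrite /cyc_dist hE; clear - id dE xn yn d0.
  move: (nat_of_ord i) (nat_of_ord x) (nat_of_ord y) id dE xn yn => j a b.
  case: (leqP a b) => ?; case: (ltnP (a + j.+1) n) => ?;
    [case: (leqP a (a + j.+1)) => ?|case: (leqP a (a + j.+1 - n)) => ?
    |case: (leqP a (a + j.+1)) => ?|case: (leqP a (a + j.+1 - n)) => ?]; lia.
have := noarc _ _ xX yY; rewrite /arc_rel ffunE /= -/d d0 (_ : d <= k) //; lia.
Qed.

Lemma inv_reach_exists n k (T : digraph n) :
  (2 * k).+1 <= n -> is_tournament T -> exists m, inv_reach (vertex_strong k) T m.
Proof.
move=> kn tT; have [s sE] := invert_seq_onto tT (circulant_tournament kn).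
exists (size s); apply/existsP; exists (in_tuple s); rewrite /= sE.
apply: cut_strong_vertex; [lia|exact: circulant_strong].
Qed.

(** * Comparing the inversion numbers *)

Lemma sinv_gen_le n (P : pred (digraph n)) D m : inv_reach P D m -> sinv_gen P D <= m.
Proof.
rewrite /sinv_gen => r; case: ClassicalEpsilon.excluded_middle_informative => //= ex.
by case: ex_minnP => m' _; apply.
Qed.

(** Reachability of [P] excludes the default value 0 on the right, which could break the inequality;
    [inv_reach_exists] supplies it. *)
Lemma sinv_gen_mono n (P Q : pred (digraph n)) D :
  (exists m, inv_reach P D m) -> (forall D', P D' -> Q D') -> sinv_gen Q D <= sinv_gen P D.
Proof.
move=> exP PQ; rewrite {2}/sinv_gen; case: ClassicalEpsilon.excluded_middle_informative => // ex.
case: ex_minnP => m /existsP[s Ps] _; apply: sinv_gen_le; apply/existsP; exists s; exact: PQ.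
Qed.

Lemma sinv'_le_sinv n k (T : digraph n) :
  (2 * k).+1 <= n -> is_tournament T -> sinv' k T <= sinv k T.
Proof.
move=> kn tT; apply: sinv_gen_mono; first exact: inv_reach_exists.
exact: vertex_arc_strong.
Qed.

Theorem theorem1p14 (k : nat) (hk : 0 < k) :
  (* N'_k(3) <= N_k(3): every threshold for m_k is a threshold for m'_k *)
  (forall N, threshold (m_k k) k 3 N -> threshold (m'_k k) k 3 N) /\
  (* N_k(3) <= 11k - 2 *)
  threshold (m_k k) k 3 (11 * k - 2) /\
  (* in particular *)
  (forall n (T : digraph n), is_tournament T -> 11 * k - 2 <= n ->
     sinv' k T <= sinv k T <= 3).
Proof.
have le3 n (T : digraph n) : is_tournament T -> 11 * k - 2 <= n -> sinv k T <= 3.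
  by move=> tT kn; apply: sinv_gen_le; exact: inv_reach3.
split; last split.
- move=> N thr n Nn kn; apply/bigmax_leqP=> T tT.
  apply: leq_trans (sinv'_le_sinv kn tT) _; apply: leq_trans (thr n Nn kn).
  exact: (@leq_bigmax_cond _ _ (fun T => sinv k T)).
- by move=> n kn _; apply/bigmax_leqP=> T tT; exact: le3.
- by move=> n T tT kn; rewrite le3 // sinv'_le_sinv //; lia.
Qed.
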